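(* Let $(A,\cdot,\{~,~,~\},\{\!\{~,~,~\}\!\})$ be an associative-Yamaguti algebra and let $(M,\cdot,\{~,~,~\},\{\!\{~,~,~\}\!\})$ be a given representation of it. Let $\mathrm{Ext}(A,M)$ be the set of all isomorphism classes of abelian extensions of $A$ by the vector space $M$ for which the induced representation on $M$ coincides with the given one. Then there is a bijection $\mathrm{Ext}(A,M)\cong\mathcal{H}^{(2,3)}(A,M)$.
   Context: All vector spaces, linear maps and tensor products are over a field $\mathbf{k}$ of characteristic $0$. An associative-Yamaguti algebra is a quadruple $(A,\cdot,\{~,~,~\},\{\!\{~,~,~\}\!\})$ consisting of a vector space $A$ with linear operations $\cdot:A\otimes A\to A$ and $\{~,~,~\},\{\!\{~,~,~\}\!\}:A\otimes A\otimes A\to A$ such that for all $a,b,c,d,e\in A$: (AY1) $(a\cdot b)\cdot c-a\cdot(b\cdot c)+\{a,b,c\}-\{\!\{a,b,c\}\!\}=0$; (AY2) $\{a\cdot b,c,d\}=\{a,b\cdot c,d\}$; (AY3) $\{a,b,c\cdot d\}=\{a,b,c\}\cdot d$; (AY4) $\{\!\{a\cdot b,c,d\}\!\}=a\cdot\{\!\{b,c,d\}\!\}$; (AY5) $\{\!\{a,b\cdot c,d\}\!\}=\{\!\{a,b,c\cdot d\}\!\}$; (AY6) $a\cdot\{b,c,d\}=\{\!\{a,b,c\}\!\}\cdot d$; (AY7) $\{\{a,b,c\},d,e\}=\{a,\{\!\{b,c,d\}\!\},e\}=\{a,b,\{c,d,e\}\}$; (AY8) $\{a,\{b,c,d\},e\}=\{\{\!\{a,b,c\}\!\},d,e\}$;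 (AY9) $\{\!\{\{\!\{a,b,c\}\!\},d,e\}\!\}=\{\!\{a,\{b,c,d\},e\}\!\}=\{\!\{a,b,\{\!\{c,d,e\}\!\}\}\!\}$; (AY10) $\{\!\{a,\{\!\{b,c,d\}\!\},e\}\!\}=\{\!\{a,b,\{c,d,e\}\}\!\}$; (AY11) $\{a,b,\{\!\{c,d,e\}\!\}\}=\{\!\{\{a,b,c\},d,e\}\!\}$. Homomorphisms are linear maps preserving the three operations. A representation of $A$ is a vector space $M$ with linear maps (denoted by the same symbols) $\cdot:A\otimes M\to M$, $\cdot:M\otimes A\to M$, and $\{~,~,~\}$ and $\{\!\{~,~,~\}\!\}$ each given by linear maps $A\otimes A\otimes M\to M$, $A\otimes M\otimes A\to M$, $M\otimes A\otimes A\to M$, such that the identities (AY1)-(AY11) hold whenever exactly one of the variables is in $M$ and the others are in $A$. A $(2,3)$-cocycle of $A$ with coefficients in $M$ is a triple $(\mu,F,G)$ of linear maps $\mu:A^{\otimes2}\to M$, $F,G:A^{\otimes3}\to M$ such that for all $a,b,c,d,e\in A$: (1) $\mu(a,b)\cdot c+\mu(a\cdot b,c)-a\cdot\mu(b,c)-\mu(a,b\cdot c)+F(a,b,c)-G(a,b,c)=0$; (2) $\{\mu(a,b),c,d\}+F(a\cdot b,c,d)=\{a,\mu(b,c),d\}+F(a,b\cdot c,d)$; (3) $\{a,b,\mu(c,d)\}+F(a,b,c\cdot d)=\mu(\{a,b,c\},d)+F(a,b,c)\cdot d$; (4) $\{\!\{\mu(a,b),c,d\}\!\}+G(a\cdot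 b,c,d)=\mu(a,\{\!\{b,c,d\}\!\})+a\cdot G(b,c,d)$; (5) $\{\!\{a,\mu(b,c),d\}\!\}+G(a,b\cdot c,d)=\{\!\{a,b,\mu(c,d)\}\!\}+G(a,b,c\cdot d)$; (6) $\mu(a,\{b,c,d\})+a\cdot F(b,c,d)=\mu(\{\!\{a,b,c\}\!\},d)+G(a,b,c)\cdot d$; (7) $\{F(a,b,c),d,e\}+F(\{a,b,c\},d,e)=\{a,G(b,c,d),e\}+F(a,\{\!\{b,c,d\}\!\},e)=\{a,b,F(c,d,e)\}+F(a,b,\{c,d,e\})$; (8) $\{a,F(b,c,d),e\}+F(a,\{b,c,d\},e)=\{G(a,b,c),d,e\}+F(\{\!\{a,b,c\}\!\},d,e)$; (9) $\{\!\{G(a,b,c),d,e\}\!\}+G(\{\!\{a,b,c\}\!\},d,e)=\{\!\{a,F(b,c,d),e\}\!\}+G(a,\{b,c,d\},e)=\{\!\{a,b,G(c,d,e)\}\!\}+G(a,b,\{\!\{c,d,e\}\!\})$; (10) $\{\!\{a,G(b,c,d),e\}\!\}+G(a,\{\!\{b,c,d\}\!\},e)=\{\!\{a,b,F(c,d,e)\}\!\}+G(a,b,\{c,d,e\})$; (11) $\{a,b,G(c,d,e)\}+F(a,b,\{\!\{c,d,e\}\!\})=\{\!\{F(a,b,c),d,e\}\!\}+G(\{a,b,c\},d,e)$. For a linear map $f:A\to M$ put $\mu_f(a,b)=f(a)\cdot b+a\cdot f(b)-f(a\cdot b)$, $F_f(a,b,c)=\{f(a),b,c\}+\{a,f(b),c\}+\{a,b,f(c)\}-f(\{a,b,c\})$,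 $G_f(a,b,c)=\{\!\{f(a),b,c\}\!\}+\{\!\{a,f(b),c\}\!\}+\{\!\{a,b,f(c)\}\!\}-f(\{\!\{a,b,c\}\!\})$. A $(2,3)$-coboundary is a cocycle of the form $(\mu_f,F_f,G_f)$ for some linear $f:A\to M$. $\mathcal{Z}^{(2,3)}(A,M)$ and $\mathcal{B}^{(2,3)}(A,M)$ are the spaces of $(2,3)$-cocycles and $(2,3)$-coboundaries, and $\mathcal{H}^{(2,3)}(A,M)=\mathcal{Z}^{(2,3)}(A,M)/\mathcal{B}^{(2,3)}(A,M)$. An abelian extension of $A$ by a vector space $M$ (regarded as an associative-Yamaguti algebra with all operations zero) is an associative-Yamaguti algebra $(E,\cdot_E,\{~,~,~\}_E,\{\!\{~,~,~\}\!\}_E)$ with a short exact sequence $0\to M\xrightarrow{i}E\xrightarrow{p}A\to0$ of associative-Yamaguti algebras. Identify $M$ with $i(M)$. For a section $s:A\to E$ (a linear map with $ps=\mathrm{Id}_A$), the induced representation on $M$ is given by $a\cdot u=s(a)\cdot_Eu$, $u\cdot a=u\cdot_Es(a)$, $\{a,b,u\}=\{s(a),s(b),u\}_E$, $\{a,u,b\}=\{s(a),u,s(b)\}_E$, $\{u,a,b\}=\{u,s(a),s(b)\}_E$, and the same formulas with $\{\!\{~,~,~\}\!\}$ in place of $\{~,~,~\}$, for $a,b\in A$, $u\in M$; it is stated that these maps make $M$ into a representation of $A$ which does not depend on the choice of $s$. Two abelian extensions $(E,i,p)$ and $(E',i',p')$ of $A$ by $M$ are isomorphic if there is an isomorphism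 $\Phi:E\to E'$ of associative-Yamaguti algebras with $\Phi\circ i=i'$ and $p'\circ\Phi=p$.
   Formalization: An abelian extension is additionally required to have both ternary operations of E vanish whenever two of the three arguments lie in M; without this the induced representation can depend on the section s, and the stated bijection can fail. *)

(* Defs.v *)
From mathcomp Require Import all_boot all_order all_algebra.
From mathcomp Require Import boolp classical_sets functions.

Set Implicit Arguments.
Unset Strict Implicit.
Unset Printing Implicit Defensive.

Import GRing.Theory.
Local Open Scope classical_set_scope.
Local Open Scope ring_scope.

Definition bilinear_map (k : fieldType) (U V W : lmodType k)
    (f : U -> V -> W) : Prop :=
  (forall u, linear (f u)) /\ (forall v, linear (fun u => f u v)).

Definition trilinear_map (k : fieldType) (U V W X : lmodType k)
    (f : U -> V -> W -> X) : Prop :=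
  [/\ forall u v, linear (f u v),
      forall u w, linear (fun v => f u v w)
    & forall v w, linear (fun u => f u v w)].

(* [br a b c] is {a, b, c} and [dbr a b c] is {{a, b, c}}. *)
Record is_ay_algebra (k : fieldType) (A : lmodType k)
    (mul : A -> A -> A) (br dbr : A -> A -> A -> A) : Prop := {
  mul_bilinear : bilinear_map mul;
  br_trilinear : trilinear_map br;
  dbr_trilinear : trilinear_map dbr;
  ay_ax1 : forall a b c,
    mul (mul a b) c - mul a (mul b c)
      + br a b c - dbr a b c = 0;
  ay_ax2 : forall a b c d,
    br (mul a b) c d = br a (mul b c) d;
  ay_ax3 : forall a b c d,
    br a b (mul c d) = mul (br a b c) d;
  ay_ax4 : forall a b c d,
    dbr (mul a b) c d = mul a (dbr b c d);
  ay_ax5 : forall a b c d,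
    dbr a (mul b c) d = dbr a b (mul c d);
  ay_ax6 : forall a b c d,
    mul a (br b c d) = mul (dbr a b c) d;
  ay_ax7 : forall a b c d e,
    br (br a b c) d e = br a (dbr b c d) e /\
    br a (dbr b c d) e = br a b (br c d e);
  ay_ax8 : forall a b c d e,
    br a (br b c d) e = br (dbr a b c) d e;
  ay_ax9 : forall a b c d e,
    dbr (dbr a b c) d e = dbr a (br b c d) e /\
    dbr a (br b c d) e = dbr a b (dbr c d e);
  ay_ax10 : forall a b c d e,
    dbr a (dbr b c d) e = dbr a b (br c d e);
  ay_ax11 : forall a b c d e,
    br a b (dbr c d e) = dbr (br a b c) d e
}.

Record ay_algebra (k : fieldType) := AYAlgebra {
  ay_sort :> lmodType k;
  ay_mul : ay_sort -> ay_sort -> ay_sort;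
  ay_br : ay_sort -> ay_sort -> ay_sort -> ay_sort;
  ay_dbr : ay_sort -> ay_sort -> ay_sort -> ay_sort;
  ay_algebraP : is_ay_algebra ay_mul ay_br ay_dbr
}.

Definition ay_hom (k : fieldType) (A B : ay_algebra k)
    (f : {linear A -> B}) : Prop :=
  [/\ forall a b, f (ay_mul a b) = ay_mul (f a) (f b),
      forall a b c, f (ay_br a b c) = ay_br (f a) (f b) (f c)
    & forall a b c, f (ay_dbr a b c) = ay_dbr (f a) (f b) (f c)].

Section ZeroAlgebra.
Variables (k : fieldType) (M : lmodType k).

Lemma ay_zeroP :
  @is_ay_algebra k M (fun _ _ => 0) (fun _ _ _ => 0) (fun _ _ _ => 0).
Proof.
have lin0 : linear (fun _ : M => 0 : M).
  by move=> c u v; rewrite scaler0 addr0.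
split=> *; by [split=> *; apply: lin0 | rewrite subr0 addr0 subr0 | split].
Qed.

Definition ay_zero : ay_algebra k := AYAlgebra ay_zeroP.
End ZeroAlgebra.

(* The suffixes A and M give the type of each argument: [brAMA a u b] is
   {a, u, b} with a, b in A and u in M. In an axiom [ay_repN_i] the i-th
   variable of the N-th algebra axiom ranges over M. *)
Record ay_rep (k : fieldType) (A : ay_algebra k) (M : lmodType k) := AYRep {
  mulAM : A -> M -> M;
  mulMA : M -> A -> M;
  brAAM : A -> A -> M -> M;
  brAMA : A -> M -> A -> M;
  brMAA : M -> A -> A -> M;
  dbrAAM : A -> A -> M -> M;
  dbrAMA : A -> M -> A -> M;
  dbrMAA : M -> A -> A -> M;
  mulAM_bilinear : bilinear_map mulAM;
  mulMA_bilinear : bilinear_map mulMA;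
  brAAM_trilinear : trilinear_map brAAM;
  brAMA_trilinear : trilinear_map brAMA;
  brMAA_trilinear : trilinear_map brMAA;
  dbrAAM_trilinear : trilinear_map dbrAAM;
  dbrAMA_trilinear : trilinear_map dbrAMA;
  dbrMAA_trilinear : trilinear_map dbrMAA;
  ay_rep1_1 : forall u b c,
    mulMA (mulMA u b) c - mulMA u (ay_mul b c)
      + brMAA u b c - dbrMAA u b c = 0;
  ay_rep1_2 : forall a u c,
    mulMA (mulAM a u) c - mulAM a (mulMA u c)
      + brAMA a u c - dbrAMA a u c = 0;
  ay_rep1_3 : forall a b u,
    mulAM (ay_mul a b) u - mulAM a (mulAM b u)
      + brAAM a b u - dbrAAM a b u = 0;
  ay_rep2_1 : forall u b c d,
    brMAA (mulMA u b) c d = brMAA u (ay_mul b c) d;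
  ay_rep2_2 : forall a u c d,
    brMAA (mulAM a u) c d = brAMA a (mulMA u c) d;
  ay_rep2_3 : forall a b u d,
    brAMA (ay_mul a b) u d = brAMA a (mulAM b u) d;
  ay_rep2_4 : forall a b c u,
    brAAM (ay_mul a b) c u = brAAM a (ay_mul b c) u;
  ay_rep3_1 : forall u b c d,
    brMAA u b (ay_mul c d) = mulMA (brMAA u b c) d;
  ay_rep3_2 : forall a u c d,
    brAMA a u (ay_mul c d) = mulMA (brAMA a u c) d;
  ay_rep3_3 : forall a b u d,
    brAAM a b (mulMA u d) = mulMA (brAAM a b u) d;
  ay_rep3_4 : forall a b c u,
    brAAM a b (mulAM c u) = mulAM (ay_br a b c) u;
  ay_rep4_1 : forall u b c d,
    dbrMAA (mulMA u b) c d = mulMA u (ay_dbr b c d);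
  ay_rep4_2 : forall a u c d,
    dbrMAA (mulAM a u) c d = mulAM a (dbrMAA u c d);
  ay_rep4_3 : forall a b u d,
    dbrAMA (ay_mul a b) u d = mulAM a (dbrAMA b u d);
  ay_rep4_4 : forall a b c u,
    dbrAAM (ay_mul a b) c u = mulAM a (dbrAAM b c u);
  ay_rep5_1 : forall u b c d,
    dbrMAA u (ay_mul b c) d = dbrMAA u b (ay_mul c d);
  ay_rep5_2 : forall a u c d,
    dbrAMA a (mulMA u c) d = dbrAMA a u (ay_mul c d);
  ay_rep5_3 : forall a b u d,
    dbrAMA a (mulAM b u) d = dbrAAM a b (mulMA u d);
  ay_rep5_4 : forall a b c u,
    dbrAAM a (ay_mul b c) u = dbrAAM a b (mulAM c u);
  ay_rep6_1 : forall u b c d,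
    mulMA u (ay_br b c d) = mulMA (dbrMAA u b c) d;
  ay_rep6_2 : forall a u c d,
    mulAM a (brMAA u c d) = mulMA (dbrAMA a u c) d;
  ay_rep6_3 : forall a b u d,
    mulAM a (brAMA b u d) = mulMA (dbrAAM a b u) d;
  ay_rep6_4 : forall a b c u,
    mulAM a (brAAM b c u) = mulAM (ay_dbr a b c) u;
  ay_rep7_1 : forall u b c d e,
    brMAA (brMAA u b c) d e = brMAA u (ay_dbr b c d) e /\
    brMAA u (ay_dbr b c d) e = brMAA u b (ay_br c d e);
  ay_rep7_2 : forall a u c d e,
    brMAA (brAMA a u c) d e = brAMA a (dbrMAA u c d) e /\
    brAMA a (dbrMAA u c d) e = brAMA a u (ay_br c d e);
  ay_rep7_3 : forall a b u d e,
    brMAA (brAAM a b u) d e = brAMA a (dbrAMA b u d) e /\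
    brAMA a (dbrAMA b u d) e = brAAM a b (brMAA u d e);
  ay_rep7_4 : forall a b c u e,
    brAMA (ay_br a b c) u e = brAMA a (dbrAAM b c u) e /\
    brAMA a (dbrAAM b c u) e = brAAM a b (brAMA c u e);
  ay_rep7_5 : forall a b c d u,
    brAAM (ay_br a b c) d u = brAAM a (ay_dbr b c d) u /\
    brAAM a (ay_dbr b c d) u = brAAM a b (brAAM c d u);
  ay_rep8_1 : forall u b c d e,
    brMAA u (ay_br b c d) e = brMAA (dbrMAA u b c) d e;
  ay_rep8_2 : forall a u c d e,
    brAMA a (brMAA u c d) e = brMAA (dbrAMA a u c) d e;
  ay_rep8_3 : forall a b u d e,
    brAMA a (brAMA b u d) e = brMAA (dbrAAM a b u) d e;
  ay_rep8_4 : forall a b c u e,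
    brAMA a (brAAM b c u) e = brAMA (ay_dbr a b c) u e;
  ay_rep8_5 : forall a b c d u,
    brAAM a (ay_br b c d) u = brAAM (ay_dbr a b c) d u;
  ay_rep9_1 : forall u b c d e,
    dbrMAA (dbrMAA u b c) d e = dbrMAA u (ay_br b c d) e /\
    dbrMAA u (ay_br b c d) e = dbrMAA u b (ay_dbr c d e);
  ay_rep9_2 : forall a u c d e,
    dbrMAA (dbrAMA a u c) d e = dbrAMA a (brMAA u c d) e /\
    dbrAMA a (brMAA u c d) e = dbrAMA a u (ay_dbr c d e);
  ay_rep9_3 : forall a b u d e,
    dbrMAA (dbrAAM a b u) d e = dbrAMA a (brAMA b u d) e /\
    dbrAMA a (brAMA b u d) e = dbrAAM a b (dbrMAA u d e);
  ay_rep9_4 : forall a b c u e,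
    dbrAMA (ay_dbr a b c) u e = dbrAMA a (brAAM b c u) e /\
    dbrAMA a (brAAM b c u) e = dbrAAM a b (dbrAMA c u e);
  ay_rep9_5 : forall a b c d u,
    dbrAAM (ay_dbr a b c) d u = dbrAAM a (ay_br b c d) u /\
    dbrAAM a (ay_br b c d) u = dbrAAM a b (dbrAAM c d u);
  ay_rep10_1 : forall u b c d e,
    dbrMAA u (ay_dbr b c d) e = dbrMAA u b (ay_br c d e);
  ay_rep10_2 : forall a u c d e,
    dbrAMA a (dbrMAA u c d) e = dbrAMA a u (ay_br c d e);
  ay_rep10_3 : forall a b u d e,
    dbrAMA a (dbrAMA b u d) e = dbrAAM a b (brMAA u d e);
  ay_rep10_4 : forall a b c u e,
    dbrAMA a (dbrAAM b c u) e = dbrAAM a b (brAMA c u e);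
  ay_rep10_5 : forall a b c d u,
    dbrAAM a (ay_dbr b c d) u = dbrAAM a b (brAAM c d u);
  ay_rep11_1 : forall u b c d e,
    brMAA u b (ay_dbr c d e) = dbrMAA (brMAA u b c) d e;
  ay_rep11_2 : forall a u c d e,
    brAMA a u (ay_dbr c d e) = dbrMAA (brAMA a u c) d e;
  ay_rep11_3 : forall a b u d e,
    brAAM a b (dbrMAA u d e) = dbrMAA (brAAM a b u) d e;
  ay_rep11_4 : forall a b c u e,
    brAAM a b (dbrAMA c u e) = dbrAMA (ay_br a b c) u e;
  ay_rep11_5 : forall a b c d u,
    brAAM a b (dbrAAM c d u) = dbrAAM (ay_br a b c) d u
}.

Section Cohomology.
Variables (k : fieldType) (A : ay_algebra k) (M : lmodType k).
Variable V : ay_rep A M.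

Definition cochain : Type :=
  ((A -> A -> M) * (A -> A -> A -> M) * (A -> A -> A -> M))%type.

Record is_cocycle (mu : A -> A -> M) (F G : A -> A -> A -> M) : Prop := {
  cocycle_mu : bilinear_map mu;
  cocycle_F : trilinear_map F;
  cocycle_G : trilinear_map G;
  cocycle1 : forall a b c,
    mulMA V (mu a b) c + mu (ay_mul a b) c - mulAM V a (mu b c)
      - mu a (ay_mul b c) + F a b c - G a b c = 0;
  cocycle2 : forall a b c d,
    brMAA V (mu a b) c d + F (ay_mul a b) c d =
    brAMA V a (mu b c) d + F a (ay_mul b c) d;
  cocycle3 : forall a b c d,
    brAAM V a b (mu c d) + F a b (ay_mul c d) =
    mu (ay_br a b c) d + mulMA V (F a b c) d;
  cocycle4 : forall a b c d,
    dbrMAA V (mu a b) c d + G (ay_mul a b) c d =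
    mu a (ay_dbr b c d) + mulAM V a (G b c d);
  cocycle5 : forall a b c d,
    dbrAMA V a (mu b c) d + G a (ay_mul b c) d =
    dbrAAM V a b (mu c d) + G a b (ay_mul c d);
  cocycle6 : forall a b c d,
    mu a (ay_br b c d) + mulAM V a (F b c d) =
    mu (ay_dbr a b c) d + mulMA V (G a b c) d;
  cocycle7 : forall a b c d e,
    brMAA V (F a b c) d e + F (ay_br a b c) d e =
    brAMA V a (G b c d) e + F a (ay_dbr b c d) e /\
    brAMA V a (G b c d) e + F a (ay_dbr b c d) e =
    brAAM V a b (F c d e) + F a b (ay_br c d e);
  cocycle8 : forall a b c d e,
    brAMA V a (F b c d) e + F a (ay_br b c d) e =
    brMAA V (G a b c) d e + F (ay_dbr a b c) d e;
  cocycle9 : forall a b c d e,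
    dbrMAA V (G a b c) d e + G (ay_dbr a b c) d e =
    dbrAMA V a (F b c d) e + G a (ay_br b c d) e /\
    dbrAMA V a (F b c d) e + G a (ay_br b c d) e =
    dbrAAM V a b (G c d e) + G a b (ay_dbr c d e);
  cocycle10 : forall a b c d e,
    dbrAMA V a (G b c d) e + G a (ay_dbr b c d) e =
    dbrAAM V a b (F c d e) + G a b (ay_br c d e);
  cocycle11 : forall a b c d e,
    brAAM V a b (G c d e) + F a b (ay_dbr c d e) =
    dbrMAA V (F a b c) d e + G (ay_br a b c) d e
}.

Definition coboundary_of (f : A -> M) : cochain :=
  (fun a b => mulMA V (f a) b + mulAM V a (f b) - f (ay_mul a b),
   fun a b c => brMAA V (f a) b c + brAMA V a (f b) c + brAAM V a b (f c)
                - f (ay_br a b c),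
   fun a b c => dbrMAA V (f a) b c + dbrAMA V a (f b) c + dbrAAM V a b (f c)
                - f (ay_dbr a b c)).

Definition cocycles : set cochain := [set z | is_cocycle z.1.1 z.1.2 z.2].

Definition coboundaries : set cochain :=
  cocycles `&` [set coboundary_of f | f in [set f : A -> M | linear f]].

Definition is_coset (C : set cochain) : Prop :=
  exists2 z, cocycles z & C = [set z + b | b in coboundaries].

Definition H23 : Type := {C : set cochain | is_coset C}.

End Cohomology.

(* An extension of A by M regarded as an algebra with zero operations. As M
   must be an abelian ideal of E, an operation of E vanishes as soon as two of
   its arguments lie in M. For the binary product this already follows from
   the injection being a homomorphism; for the ternary operations with one
   argument outside M it does not, and then the induced representation may
   depend on the section used to define it. *)
Record ab_extension (k : fieldType) (A : ay_algebra k) (M : lmodType k) :=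
    AbExtension {
  ext_alg :> ay_algebra k;
  ext_inj : {linear ay_zero M -> ext_alg};
  ext_proj : {linear ext_alg -> A};
  ext_inj_hom : ay_hom ext_inj;
  ext_proj_hom : ay_hom ext_proj;
  ext_inj_injective : injective ext_inj;
  ext_proj_surjective : forall a, exists x, ext_proj x = a;
  ext_exact : forall x, ext_proj x = 0 <-> exists u, x = ext_inj u;
  ext_abelian_br : forall x u v,
    [/\ ay_br x (ext_inj u) (ext_inj v) = 0,
        ay_br (ext_inj u) x (ext_inj v) = 0
      & ay_br (ext_inj u) (ext_inj v) x = 0];
  ext_abelian_dbr : forall x u v,
    [/\ ay_dbr x (ext_inj u) (ext_inj v) = 0,
        ay_dbr (ext_inj u) x (ext_inj v) = 0
      & ay_dbr (ext_inj u) (ext_inj v) x = 0]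
}.

Section Extensions.
Variables (k : fieldType) (A : ay_algebra k) (M : lmodType k).

Definition is_section (E : ab_extension A M) (s : {linear A -> E}) : Prop :=
  forall a, ext_proj E (s a) = a.

Record induces_via (V : ay_rep A M) (E : ab_extension A M)
    (s : {linear A -> E}) : Prop := {
  induced_mulAM : forall a u,
    ext_inj E (mulAM V a u) = ay_mul (s a) (ext_inj E u);
  induced_mulMA : forall u a,
    ext_inj E (mulMA V u a) = ay_mul (ext_inj E u) (s a);
  induced_brAAM : forall a b u,
    ext_inj E (brAAM V a b u) = ay_br (s a) (s b) (ext_inj E u);
  induced_brAMA : forall a u b,
    ext_inj E (brAMA V a u b) = ay_br (s a) (ext_inj E u) (s b);
  induced_brMAA : forall u a b,
    ext_inj E (brMAA V u a b) = ay_br (ext_inj E u) (s a) (s b);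
  induced_dbrAAM : forall a b u,
    ext_inj E (dbrAAM V a b u) = ay_dbr (s a) (s b) (ext_inj E u);
  induced_dbrAMA : forall a u b,
    ext_inj E (dbrAMA V a u b) = ay_dbr (s a) (ext_inj E u) (s b);
  induced_dbrMAA : forall u a b,
    ext_inj E (dbrMAA V u a b) = ay_dbr (ext_inj E u) (s a) (s b)
}.

Definition induces (V : ay_rep A M) (E : ab_extension A M) : Prop :=
  forall s : {linear A -> E}, is_section s -> induces_via V s.

Definition ext_iso (E E' : ab_extension A M) : Prop :=
  exists Phi : {linear E -> E'},
    [/\ ay_hom Phi, bijective Phi,
        forall u, Phi (ext_inj E u) = ext_inj E' u
      & forall x, ext_proj E' (Phi x) = ext_proj E x].

(* A plain predicate is used because [set (ab_extension A M)] raises a universe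
   inconsistency. *)
Definition is_iso_class (V : ay_rep A M)
    (C : ab_extension A M -> Prop) : Prop :=
  exists2 E, induces V E & C = ext_iso E.

Definition Ext (V : ay_rep A M) : Type :=
  {C : ab_extension A M -> Prop | is_iso_class V C}.

End Extensions.

(* Main.v *)
(* The direct sum A * M carries "twisted" operations built from the representation
   and a triple (mu, F, G); they form an associative-Yamaguti algebra exactly when
   the triple is a cocycle, the cocycle identities being the algebra identities
   evaluated on A * 0. A linear section (it exists by Zorn's lemma) identifies any
   extension with such a twisted one, and the isomorphisms between two twisted
   extensions are the shears (a, u) |-> (a, u + f a), which change the cocycle by
   the coboundary of f. *)
Require Import Defs.
From HB Require Import structures.
From mathcomp Require Import all_boot all_order all_algebra.
From mathcomp Require Import boolp classical_sets functions.

Set Implicit Arguments.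
Unset Strict Implicit.
Unset Printing Implicit Defensive.

Import GRing.Theory.
Local Open Scope classical_set_scope.
Local Open Scope ring_scope.

(** * Linear maps, and linear sections of surjections *)

Section LinearMaps.
Variable k : fieldType.
Implicit Types U V W : lmodType k.

Definition linear_pack U V (f : U -> V) (lf : linear f) : {linear U -> V} :=
  HB.pack f (GRing.isLinear.Build k U V *:%R f lf).

Lemma linear_propD U V (f : U -> V) : linear f -> {morph f : x y / x + y}.
Proof. by move=> lf x y; apply: (linearD (linear_pack lf)). Qed.

Lemma linear_prop0 U V (f : U -> V) : linear f -> f 0 = 0.
Proof. by move=> lf; apply: (linear0 (linear_pack lf)). Qed.

Lemma linear_add U V (f g : U -> V) :
  linear f -> linear g -> linear (fun x => f x + g x).
Proof. by move=> lf lg c x y; rewrite lf lg scalerDr addrACA. Qed.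

Lemma linear_comp U V W (f : V -> W) (g : U -> V) :
  linear f -> linear g -> linear (fun x => f (g x)).
Proof. by move=> lf lg c x y; rewrite lg lf. Qed.

Lemma linear_fst U V : linear (@fst U V).
Proof. by []. Qed.

Lemma linear_snd U V : linear (@snd U V).
Proof. by []. Qed.

Lemma linear_pair U V W (f : U -> V) (g : U -> W) :
  linear f -> linear g -> linear (fun x => (f x, g x)).
Proof. by move=> lf lg c x y; rewrite lf lg. Qed.

Lemma linear_const0 U V : linear (fun _ : U => 0 : V).
Proof. by move=> c x y; rewrite scaler0 addr0. Qed.

Lemma linear_inverse U V (f : {linear U -> V}) (g : V -> U) :
  cancel f g -> cancel g f -> linear g.
Proof. by move=> fK gK c x y; apply: (can_inj fK); rewrite linearP !gK. Qed.

(** Zorn's lemma gives a maximal [W] that meets the kernel of [p] only in 0. Maximality makes [p]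
    map [W] onto [V], and the section is the inverse of [p] restricted to [W]. *)
Lemma linear_section U V (p : {linear U -> V}) :
  (forall y, exists x, p x = y) ->
  exists s : {linear V -> U}, forall y, p (s y) = y.
Proof.
move=> p_surj.
(* The empty set is deliberately allowed: it is the union of the empty chain. *)
pose indep (W : set U) := (forall c x y, W x -> W y -> W (c *: x + y)) /\
  (forall x, W x -> p x = 0 -> x = 0).
have [F FP Ftot|W [[Wlin Wker] Wmax]] := @Zorn_bigcup U indep.
  split=> [c x y [X FX Xx] [Y FY Yy]|x [X /FP[_ Xker] Xx]]; last exact: Xker.
  have [XY|YX] := Ftot X Y FX FY.
    by exists Y => //; have [Ylin _] := FP Y FY; apply: Ylin => //; apply: XY.
  by exists X => //; have [Xlin _] := FP X FX; apply: Xlin => //; apply: YX.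
have maxW B : indep B -> W `<=` B -> B `<=` W.
  by move=> BP WB; apply: contrapT => BW; case: (Wmax B (conj WB BW)).
(* A priori [W] could be empty; adjoining 0 preserves [indep], so maximality puts 0 in [W]. *)
have W0 : W 0.
  apply: (maxW [set x | x = 0 \/ W x]) => /=; [split|by move=> x; right|by left].
    move=> c x y [->|Wx] [->|Wy]; rewrite ?scaler0 ?add0r ?addr0.
    - by left.
    - by right.
    (* [W] is not yet known to contain 0, so the multiple of [x] by [c] is obtained as
       [(c - 1) *: x + x]. *)
    - right; have /(_ (c - 1)) := Wlin _ x x Wx Wx.
      by rewrite -{2}[x]scale1r -scalerDl subrK.
    - by right; apply: Wlin.
  by move=> x [//|]; apply: Wker.
(* If [y] had no preimage in [W], a preimage [e] of [y] could be adjoined: a kernel element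
   [c *: e + w] with [c] nonzero would make [y] the image of [- c^-1 *: w]. *)
have Wsurj y : exists2 x, W x & p x = y.
  apply: contrapT => Wy; have [e pe] := p_surj y.
  suff We : W e by apply: Wy; exists e.
  apply: (maxW [set x | exists c w, W w /\ x = c *: e + w]) => /=.
  - split=> [c _ _ [d [w [Ww ->]]] [d' [w' [Ww' ->]]]|_ [c [w [Ww ->]]]].
      exists (c * d + d'), (c *: w + w'); split; first exact: Wlin.
      by rewrite scalerDr scalerA addrACA -scalerDl.
    rewrite linearP pe => pw0; have [c0|c0] := eqVneq c 0.
      by move: pw0; rewrite c0 !scale0r !add0r; apply: Wker.
    case: Wy; exists (- c^-1 *: w + 0); first exact: Wlin.
    rewrite addr0 linearZ/=; move/eqP: pw0; rewrite addrC addr_eq0 => /eqP->.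
    by rewrite scalerN scaleNr opprK scalerA mulVf// scale1r.
  - by move=> x Wx; exists 0, x; rewrite scale0r add0r.
  - by exists 1, 0; rewrite scale1r addr0.
have /choice[s sP] : forall y, exists x, W x /\ p x = y.
  by move=> y; have [x] := Wsurj y; exists x.
(* The defect of linearity of [s] lies in [W] and in the kernel of [p], so it is 0. *)
have s_lin : linear s.
  move=> c x y; apply/eqP; rewrite -subr_eq0; apply/eqP.
  have [[Ws ps] [[Wx px] [Wy py]]] := (sP (c *: x + y), (sP x, sP y)).
  apply: Wker; last by rewrite linearB/= linearP ps px py subrr.
  rewrite [X in W X]addrC -scaleN1r.
  exact: (Wlin _ _ _ (Wlin c _ _ Wx Wy) Ws).
by exists (linear_pack s_lin) => y; case: (sP y).
Qed.

End LinearMaps.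

(** Each axiom, multilinearity included, is an equation that can be checked after applying the
    injective map [f], where it becomes an axiom of [E]. This avoids verifying the identities by
    hand, both for shears and for the splitting of an extension. *)
Lemma ay_transport (k : fieldType) (X : lmodType k) (E : ay_algebra k)
    (mul : X -> X -> X) (br dbr : X -> X -> X -> X) (f : {linear X -> E}) :
  injective f ->
  (forall x y, f (mul x y) = ay_mul (f x) (f y)) ->
  (forall x y z, f (br x y z) = ay_br (f x) (f y) (f z)) ->
  (forall x y z, f (dbr x y z) = ay_dbr (f x) (f y) (f z)) ->
  is_ay_algebra mul br dbr.
Proof.
move=> f_inj fmul fbr fdbr.
case: (ay_algebraP E) => -[ml mr] [bl bm bz] [dl dm dz].
move=> e1 e2 e3 e4 e5 e6 e7 e8 e9 e10 e11.
split.
- by split=> *; move=> c x y; apply: f_inj; rewrite linearP !fmul linearP (ml, mr).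
- by split=> *; move=> c x y; apply: f_inj; rewrite linearP !fbr linearP (bl, bm, bz).
- by split=> *; move=> c x y; apply: f_inj; rewrite linearP !fdbr linearP (dl, dm, dz).
- by move=> *; apply: f_inj; rewrite linear0 !(linearB, linearD)/= ?(fmul, fbr, fdbr).
all: move=> *; try split; apply: f_inj; rewrite ?(fmul, fbr, fdbr).
all: first [exact: e2 | exact: e3 | exact: e4 | exact: e5 | exact: e6
  | exact: e8 | exact: e10 | exact: e11
  | exact: (proj1 (e7 _ _ _ _ _)) | exact: (proj2 (e7 _ _ _ _ _))
  | exact: (proj1 (e9 _ _ _ _ _)) | exact: (proj2 (e9 _ _ _ _ _))].
Qed.

(** * Additivity and vanishing of multilinear maps *)

Section Multilinear.
Variables (k : fieldType) (U V W X : lmodType k).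

Section Bilinear.
Variables (f : U -> V -> W) (fP : bilinear_map f).

Lemma bilinear_Dl u u' v : f (u + u') v = f u v + f u' v.
Proof. by case: fP => _ /(_ v)/linear_propD. Qed.

Lemma bilinear_Dr u v v' : f u (v + v') = f u v + f u v'.
Proof. by case: fP => /(_ u)/linear_propD. Qed.

Lemma bilinear_0l v : f 0 v = 0.
Proof. by case: fP => _ /(_ v)/linear_prop0. Qed.

Lemma bilinear_0r u : f u 0 = 0.
Proof. by case: fP => /(_ u)/linear_prop0. Qed.

End Bilinear.

Section Trilinear.
Variables (f : U -> V -> W -> X) (fP : trilinear_map f).

Lemma trilinear_D1 u u' v w : f (u + u') v w = f u v w + f u' v w.
Proof. by case: fP => _ _ /(_ v w)/linear_propD. Qed.

Lemma trilinear_D2 u v v' w : f u (v + v') w = f u v w + f u v' w.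
Proof. by case: fP => _ /(_ u w)/linear_propD. Qed.

Lemma trilinear_D3 u v w w' : f u v (w + w') = f u v w + f u v w'.
Proof. by case: fP => /(_ u v)/linear_propD. Qed.

Lemma trilinear_01 v w : f 0 v w = 0.
Proof. by case: fP => _ _ /(_ v w)/linear_prop0. Qed.

Lemma trilinear_02 u w : f u 0 w = 0.
Proof. by case: fP => _ /(_ u w)/linear_prop0. Qed.

Lemma trilinear_03 u v : f u v 0 = 0.
Proof. by case: fP => /(_ u v)/linear_prop0. Qed.

End Trilinear.
End Multilinear.

(** Adds a known identity to the goal. Once all relevant identities have been added, usually
    reversed by [esym], both sides consist of the same terms and [abelian] only has to match
    them. *)
Lemma addr_eq_trade (V : zmodType) (x y u v : V) : u = v -> x + u = y + v -> x = y.
Proof. by move=> ->; apply: addIr. Qed.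

(* Cancels the last term of the left-hand side on both sides, repeatedly. *)
Ltac abelian :=
  rewrite ?opprD ?oppr0 ?addr0 ?add0r ?addrA;
  repeat (lazymatch goal with |- _ + ?t = _ =>
    repeat rewrite [in RHS](addrAC _ t); rewrite ?[t + _ in RHS]addrC;
    apply: (congr1 (fun w => w + t)) end);
  try reflexivity.

(** * Twisted operations on [A * M] *)

Section Twist.
Variables (k : fieldType) (A : ay_algebra k) (M : lmodType k) (V : ay_rep A M).
Implicit Types (mu : A -> A -> M) (F G : A -> A -> A -> M) (x y t : A * M)
  (z : cochain A M).

(** For [mu] zero this is the product of the semidirect product of [A] and [M]. No term involves two
    elements of [M], so [M] becomes an abelian ideal. *)
Definition twist_mul mu x y : A * M :=
  (ay_mul x.1 y.1, mulMA V x.2 y.1 + mulAM V x.1 y.2 + mu x.1 y.1).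

Definition twist_br F x y t : A * M :=
  (ay_br x.1 y.1 t.1, brMAA V x.2 y.1 t.1 + brAMA V x.1 y.2 t.1
    + brAAM V x.1 y.1 t.2 + F x.1 y.1 t.1).

Definition twist_dbr G x y t : A * M :=
  (ay_dbr x.1 y.1 t.1, dbrMAA V x.2 y.1 t.1 + dbrAMA V x.1 y.2 t.1
    + dbrAAM V x.1 y.1 t.2 + G x.1 y.1 t.1).

Definition rep_D := (bilinear_Dr (mulAM_bilinear V), bilinear_Dl (mulMA_bilinear V),
  trilinear_D3 (brAAM_trilinear V), trilinear_D2 (brAMA_trilinear V),
  trilinear_D1 (brMAA_trilinear V), trilinear_D3 (dbrAAM_trilinear V),
  trilinear_D2 (dbrAMA_trilinear V), trilinear_D1 (dbrMAA_trilinear V)).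

Definition rep_0 := (bilinear_0r (mulAM_bilinear V), bilinear_0l (mulMA_bilinear V),
  trilinear_03 (brAAM_trilinear V), trilinear_02 (brAMA_trilinear V),
  trilinear_01 (brMAA_trilinear V), trilinear_03 (dbrAAM_trilinear V),
  trilinear_02 (dbrAMA_trilinear V), trilinear_01 (dbrMAA_trilinear V)).

Lemma twist_mul_bilinear mu : bilinear_map mu -> bilinear_map (twist_mul mu).
Proof.
move=> [ml mr]; case: (ay_algebraP A) => -[al ar] _ _ *.
case: (mulAM_bilinear V) (mulMA_bilinear V) => [AMl AMr] [MAl MAr].
split=> x; apply: linear_pair.
- exact: (linear_comp (al _) (@linear_fst k A M)).
- do !apply: linear_add.
  + exact: (linear_comp (MAl _) (@linear_fst k A M)).
  + exact: (linear_comp (AMl _) (@linear_snd k A M)).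
  + exact: (linear_comp (ml _) (@linear_fst k A M)).
- exact: (linear_comp (ar _) (@linear_fst k A M)).
- do !apply: linear_add.
  + exact: (linear_comp (MAr _) (@linear_snd k A M)).
  + exact: (linear_comp (AMr _) (@linear_fst k A M)).
  + exact: (linear_comp (mr _) (@linear_fst k A M)).
Qed.

(** Abstract components let one proof serve both ternary operations. Each summand is trilinear
    because it uses every variable through exactly one of its projections. *)
Lemma twist_trilinear (g : A -> A -> A -> A) (f1 : M -> A -> A -> M)
    (f2 : A -> M -> A -> M) (f3 : A -> A -> M -> M) (F : A -> A -> A -> M) :
  trilinear_map g -> trilinear_map f1 -> trilinear_map f2 -> trilinear_map f3 ->
  trilinear_map F ->
  trilinear_map (fun x y z : A * M => (g x.1 y.1 z.1,
    f1 x.2 y.1 z.1 + f2 x.1 y.2 z.1 + f3 x.1 y.1 z.2 + F x.1 y.1 z.1)).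
Proof.
move=> [g3 g2 g1] [f13 f12 f11] [f23 f22 f21] [f33 f32 f31] [F3 F2 F1].
have fstl := @linear_fst k A M; have sndl := @linear_snd k A M.
split=> x y; apply: linear_pair; do ?apply: linear_add.
- exact: (linear_comp (g3 _ _) fstl).
- exact: (linear_comp (f13 _ _) fstl).
- exact: (linear_comp (f23 _ _) fstl).
- exact: (linear_comp (f33 _ _) sndl).
- exact: (linear_comp (F3 _ _) fstl).
- exact: (linear_comp (g2 _ _) fstl).
- exact: (linear_comp (f12 _ _) fstl).
- exact: (linear_comp (f22 _ _) sndl).
- exact: (linear_comp (f32 _ _) fstl).
- exact: (linear_comp (F2 _ _) fstl).
- exact: (linear_comp (g1 _ _) fstl).
- exact: (linear_comp (f11 _ _) sndl).
- exact: (linear_comp (f21 _ _) fstl).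
- exact: (linear_comp (f31 _ _) fstl).
- exact: (linear_comp (F1 _ _) fstl).
Qed.

(** The first component of each axiom is the axiom in [A]. The second splits by the variable that
    contributes its [M]-part, giving one representation axiom per variable; the terms with no
    [M]-part form the cocycle identity. *)
Lemma cocycle_twist mu F G : is_cocycle V mu F G ->
  is_ay_algebra (twist_mul mu) (twist_br F) (twist_dbr G).
Proof.
move=> zP; have P := ay_algebraP A; split.
- exact/twist_mul_bilinear/(cocycle_mu zP).
- apply: twist_trilinear (br_trilinear P) _ _ _ (cocycle_F zP).
  + exact: brMAA_trilinear.
  + exact: brAMA_trilinear.
  + exact: brAAM_trilinear.
- apply: twist_trilinear (dbr_trilinear P) _ _ _ (cocycle_G zP).
  + exact: dbrMAA_trilinear.
  + exact: dbrAMA_trilinear.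
  + exact: dbrAAM_trilinear.
- move=> [a u] [b v] [c w]; apply: injective_projections => /=.
    exact: (ay_ax1 P).
  rewrite !rep_D.
  apply: (addr_eq_trade (esym (ay_rep1_1 V u b c))).
  apply: (addr_eq_trade (esym (ay_rep1_2 V a v c))).
  apply: (addr_eq_trade (esym (ay_rep1_3 V a b w))).
  apply: (addr_eq_trade (esym (cocycle1 zP a b c))).
  abelian.
- move=> [a u] [b v] [c w] [d t]; apply: injective_projections => /=.
    exact: (ay_ax2 P).
  rewrite !rep_D (ay_rep2_1 V) (ay_rep2_2 V) (ay_rep2_3 V) (ay_rep2_4 V).
  apply: (addr_eq_trade (esym (cocycle2 zP a b c d))); abelian.
- move=> [a u] [b v] [c w] [d t]; apply: injective_projections => /=.
    exact: (ay_ax3 P).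
  rewrite !rep_D -(ay_rep3_1 V) -(ay_rep3_2 V) -(ay_rep3_3 V) -(ay_rep3_4 V).
  apply: (addr_eq_trade (esym (cocycle3 zP a b c d))); abelian.
- move=> [a u] [b v] [c w] [d t]; apply: injective_projections => /=.
    exact: (ay_ax4 P).
  rewrite !rep_D (ay_rep4_1 V) (ay_rep4_2 V) (ay_rep4_3 V) (ay_rep4_4 V).
  apply: (addr_eq_trade (esym (cocycle4 zP a b c d))); abelian.
- move=> [a u] [b v] [c w] [d t]; apply: injective_projections => /=.
    exact: (ay_ax5 P).
  rewrite !rep_D (ay_rep5_1 V) (ay_rep5_2 V) (ay_rep5_3 V) (ay_rep5_4 V).
  apply: (addr_eq_trade (esym (cocycle5 zP a b c d))); abelian.
- move=> [a u] [b v] [c w] [d t]; apply: injective_projections => /=.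
    exact: (ay_ax6 P).
  rewrite !rep_D (ay_rep6_1 V) (ay_rep6_2 V) (ay_rep6_3 V) (ay_rep6_4 V).
  apply: (addr_eq_trade (esym (cocycle6 zP a b c d))); abelian.
- move=> [a u] [b v] [c w] [d t] [e r].
  have [P1 P2] := ay_ax7 P a b c d e.
  have [z1 z2] := cocycle7 zP a b c d e.
  have [[r11 r12] [r21 r22] [r31 r32]] :=
    And3 (ay_rep7_1 V u b c d e) (ay_rep7_2 V a v c d e) (ay_rep7_3 V a b w d e).
  have [[r41 r42] [r51 r52]] := (ay_rep7_4 V a b c t e, ay_rep7_5 V a b c d r).
  split; apply: injective_projections => //=; rewrite !rep_D.
    rewrite r11 r21 r31 r41 r51; apply: (addr_eq_trade (esym z1)); abelian.
  rewrite r12 r22 r32 r42 r52; apply: (addr_eq_trade (esym z2)); abelian.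
- move=> [a u] [b v] [c w] [d t] [e r]; apply: injective_projections => /=.
    exact: (ay_ax8 P).
  rewrite !rep_D (ay_rep8_1 V) (ay_rep8_2 V) (ay_rep8_3 V) (ay_rep8_4 V) (ay_rep8_5 V).
  apply: (addr_eq_trade (esym (cocycle8 zP a b c d e))); abelian.
- move=> [a u] [b v] [c w] [d t] [e r].
  have [P1 P2] := ay_ax9 P a b c d e.
  have [z1 z2] := cocycle9 zP a b c d e.
  have [[r11 r12] [r21 r22] [r31 r32]] :=
    And3 (ay_rep9_1 V u b c d e) (ay_rep9_2 V a v c d e) (ay_rep9_3 V a b w d e).
  have [[r41 r42] [r51 r52]] := (ay_rep9_4 V a b c t e, ay_rep9_5 V a b c d r).
  split; apply: injective_projections => //=; rewrite !rep_D.
    rewrite r11 r21 r31 r41 r51; apply: (addr_eq_trade (esym z1)); abelian.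
  rewrite r12 r22 r32 r42 r52; apply: (addr_eq_trade (esym z2)); abelian.
- move=> [a u] [b v] [c w] [d t] [e r]; apply: injective_projections => /=.
    exact: (ay_ax10 P).
  rewrite !rep_D (ay_rep10_1 V) (ay_rep10_2 V) (ay_rep10_3 V) (ay_rep10_4 V) (ay_rep10_5 V).
  apply: (addr_eq_trade (esym (cocycle10 zP a b c d e))); abelian.
- move=> [a u] [b v] [c w] [d t] [e r]; apply: injective_projections => /=.
    exact: (ay_ax11 P).
  rewrite !rep_D (ay_rep11_1 V) (ay_rep11_2 V) (ay_rep11_3 V) (ay_rep11_4 V) (ay_rep11_5 V).
  apply: (addr_eq_trade (esym (cocycle11 zP a b c d e))); abelian.
Qed.

(** On vectors [(a, 0)] the terms containing an [M]-part vanish by [rep_0], so the second component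
    of each axiom reduces to the cocycle condition; multilinearity of the triple is read off in the
    same way. *)
Lemma twist_cocycle mu F G :
  is_ay_algebra (twist_mul mu) (twist_br F) (twist_dbr G) -> is_cocycle V mu F G.
Proof.
move=> P; split.
- case: (mul_bilinear P) => l r; split=> a c x y.
    have /(congr1 snd) := l (a, 0) c (x, 0) (y, 0).
    by rewrite /= ?(scaler0, addr0, add0r, rep_0).
  have /(congr1 snd) := r (a, 0) c (x, 0) (y, 0).
  by rewrite /= ?(scaler0, addr0, add0r, rep_0).
- case: (br_trilinear P) => l3 l2 l1; split=> a b c x y.
  + have /(congr1 snd) := l3 (a, 0) (b, 0) c (x, 0) (y, 0).
    by rewrite /= ?(scaler0, addr0, add0r, rep_0).
  + have /(congr1 snd) := l2 (a, 0) (b, 0) c (x, 0) (y, 0).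
    by rewrite /= ?(scaler0, addr0, add0r, rep_0).
  + have /(congr1 snd) := l1 (a, 0) (b, 0) c (x, 0) (y, 0).
    by rewrite /= ?(scaler0, addr0, add0r, rep_0).
- case: (dbr_trilinear P) => l3 l2 l1; split=> a b c x y.
  + have /(congr1 snd) := l3 (a, 0) (b, 0) c (x, 0) (y, 0).
    by rewrite /= ?(scaler0, addr0, add0r, rep_0).
  + have /(congr1 snd) := l2 (a, 0) (b, 0) c (x, 0) (y, 0).
    by rewrite /= ?(scaler0, addr0, add0r, rep_0).
  + have /(congr1 snd) := l1 (a, 0) (b, 0) c (x, 0) (y, 0).
    by rewrite /= ?(scaler0, addr0, add0r, rep_0).
- move=> a b c; have /(congr1 snd) := ay_ax1 P (a, 0) (b, 0) (c, 0).
  by rewrite /= ?(addr0, add0r, rep_0) opprD !addrA.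
- move=> a b c d; have /(congr1 snd) := ay_ax2 P (a, 0) (b, 0) (c, 0) (d, 0).
  by rewrite /= ?(addr0, add0r, rep_0).
- move=> a b c d; have /(congr1 snd) := ay_ax3 P (a, 0) (b, 0) (c, 0) (d, 0).
  by rewrite /= ?(addr0, add0r, rep_0) => ->; rewrite addrC.
- move=> a b c d; have /(congr1 snd) := ay_ax4 P (a, 0) (b, 0) (c, 0) (d, 0).
  by rewrite /= ?(addr0, add0r, rep_0) => ->; rewrite addrC.
- move=> a b c d; have /(congr1 snd) := ay_ax5 P (a, 0) (b, 0) (c, 0) (d, 0).
  by rewrite /= ?(addr0, add0r, rep_0).
- move=> a b c d; have /(congr1 snd) := ay_ax6 P (a, 0) (b, 0) (c, 0) (d, 0).
  by rewrite /= ?(addr0, add0r, rep_0) addrC => ->; rewrite addrC.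
- move=> a b c d e.
  have [] := ay_ax7 P (a, 0) (b, 0) (c, 0) (d, 0) (e, 0).
  by move=> /(congr1 snd) + /(congr1 snd); rewrite /= ?(addr0, add0r, rep_0).
- move=> a b c d e.
  have /(congr1 snd) := ay_ax8 P (a, 0) (b, 0) (c, 0) (d, 0) (e, 0).
  by rewrite /= ?(addr0, add0r, rep_0).
- move=> a b c d e.
  have [] := ay_ax9 P (a, 0) (b, 0) (c, 0) (d, 0) (e, 0).
  by move=> /(congr1 snd) + /(congr1 snd); rewrite /= ?(addr0, add0r, rep_0).
- move=> a b c d e.
  have /(congr1 snd) := ay_ax10 P (a, 0) (b, 0) (c, 0) (d, 0) (e, 0).
  by rewrite /= ?(addr0, add0r, rep_0).
- move=> a b c d e.
  have /(congr1 snd) := ay_ax11 P (a, 0) (b, 0) (c, 0) (d, 0) (e, 0).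
  by rewrite /= ?(addr0, add0r, rep_0).
Qed.

Lemma cocycle0 : is_cocycle V (fun _ _ => 0) (fun _ _ _ => 0) (fun _ _ _ => 0).
Proof.
have lin0 := @linear_const0 k A M.
by split=> *; do ?split=> *; rewrite ?rep_0 ?(subr0, addr0) //; apply: lin0.
Qed.

(** * Shears and the change of cocycle *)

Section Shear.
Variable f : A -> M.

Definition shear x : A * M := (x.1, x.2 + f x.1).

Lemma shear_linear : linear f -> linear shear.
Proof.
move=> lf; apply: linear_pair; first exact: linear_fst.
exact: (linear_add (@linear_snd k A M) (linear_comp lf (@linear_fst k A M))).
Qed.

Lemma shear_inj : injective shear.
Proof. by move=> [a u] [b v] [-> /addIr->]. Qed.

(** Expanding the right-hand side produces [mulMA V (f a) b + mulAM V a (f b)]. The left-hand side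
    has [f (ay_mul a b)] instead, and the difference is the coboundary of [f]. *)
Lemma shear_mul z x y :
  shear (twist_mul (z + coboundary_of V f).1.1 x y) =
  twist_mul z.1.1 (shear x) (shear y).
Proof.
case: x y => [a u] [b v]; apply: injective_projections => //=.
rewrite !rep_D -[(z.1.1 + _) a b]/(z.1.1 a b + (coboundary_of V f).1.1 a b) /=.
(* The value [f (ay_mul a b)] occurs on the left with both signs; it is added to the right with both
   signs because [abelian] matches terms across the equation. *)
by apply: (addr_eq_trade (esym (subrr (f (ay_mul a b))))); abelian.
Qed.

Lemma shear_br z x y t :
  shear (twist_br (z + coboundary_of V f).1.2 x y t) =
  twist_br z.1.2 (shear x) (shear y) (shear t).
Proof.
case: x y t => [a u] [b v] [c w]; apply: injective_projections => //=.
rewrite !rep_D -[(z.1.2 + _) a b c]/(z.1.2 a b c + (coboundary_of V f).1.2 a b c) /=.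
by apply: (addr_eq_trade (esym (subrr (f (ay_br a b c))))); abelian.
Qed.

Lemma shear_dbr z x y t :
  shear (twist_dbr (z + coboundary_of V f).2 x y t) =
  twist_dbr z.2 (shear x) (shear y) (shear t).
Proof.
case: x y t => [a u] [b v] [c w]; apply: injective_projections => //=.
rewrite !rep_D -[(z.2 + _) a b c]/(z.2 a b c + (coboundary_of V f).2 a b c) /=.
by apply: (addr_eq_trade (esym (subrr (f (ay_dbr a b c))))); abelian.
Qed.

(** No cocycle identity is expanded: the shear carries the algebra axioms from the twist by [z] to
    the twist by the shifted triple, and [twist_cocycle] reads them back. *)
Lemma cocycles_add_coboundary z :
  linear f -> cocycles V z -> cocycles V (z + coboundary_of V f).
Proof.
move=> lf /cocycle_twist zP; apply: twist_cocycle.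
apply: (@ay_transport _ _ (AYAlgebra zP) _ _ _ (linear_pack (shear_linear lf))).
- exact: shear_inj.
- exact: shear_mul.
- exact: shear_br.
- exact: shear_dbr.
Qed.

End Shear.

(** * Coboundaries and their cosets *)

Lemma coboundaries_of (f : A -> M) :
  linear f -> coboundaries V (coboundary_of V f).
Proof.
move=> lf; split; last by exists f.
(* Shifting the zero cocycle gives the cocycle condition that is part of [coboundaries]. *)
rewrite -[coboundary_of V f]add0r; apply: cocycles_add_coboundary => //.
exact: cocycle0.
Qed.

Lemma coboundary_ofD (f g : A -> M) :
  coboundary_of V (fun a => f a + g a) = coboundary_of V f + coboundary_of V g.
Proof.
apply: injective_projections; first apply: injective_projections.
- apply/funext => a; apply/funext => b.
  rewrite -[RHS]/((coboundary_of V f).1.1 a b + (coboundary_of V g).1.1 a b) /=.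
  by rewrite !rep_D; abelian.
- apply/funext => a; apply/funext => b; apply/funext => c.
  rewrite -[RHS]/((coboundary_of V f).1.2 a b c + (coboundary_of V g).1.2 a b c) /=.
  by rewrite !rep_D; abelian.
- apply/funext => a; apply/funext => b; apply/funext => c.
  rewrite -[RHS]/((coboundary_of V f).2 a b c + (coboundary_of V g).2 a b c) /=.
  by rewrite !rep_D; abelian.
Qed.

Lemma coboundary_of0 : coboundary_of V (fun=> 0) = 0.
Proof.
apply: (@addrI _ (coboundary_of V (fun=> 0))).
by rewrite -coboundary_ofD !addr0.
Qed.

Definition coset z : set (cochain A M) := [set z + b | b in coboundaries V].

Lemma coset_refl z : coset z z.
Proof.
exists 0; last exact: addr0.
by rewrite -coboundary_of0; apply: coboundaries_of; apply: linear_const0.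
Qed.

Lemma coset_sub z (f : A -> M) :
  linear f -> coset (z + coboundary_of V f) `<=` coset z.
Proof.
move=> lf _ [_ [_ [g lg <-]] <-]; rewrite -addrA -coboundary_ofD.
by exists (coboundary_of V (fun a => f a + g a)) => //; apply/coboundaries_of/linear_add.
Qed.

(** Shifting back by the coboundary of [- f] recovers [z], so [coset_sub] gives both inclusions. *)
Lemma coset_eq z (f : A -> M) :
  linear f -> coset (z + coboundary_of V f) = coset z.
Proof.
move=> lf; apply/seteqP; split; first exact: coset_sub.
have lN : linear (fun a => - f a) by move=> c x y; rewrite lf opprD scalerN.
rewrite -[X in coset X `<=` _](_ : z + coboundary_of V f + coboundary_of V (fun a => - f a) = z).
  exact: coset_sub.
rewrite -addrA -coboundary_ofD (_ : (fun _ => _) = fun=> 0) ?coboundary_of0 ?addr0//.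
by apply/funext => x; rewrite subrr.
Qed.

(** * The extension attached to a cocycle *)

Section TwistExtension.
Variables (z : cochain A M) (zP : cocycles V z).

Definition twist_alg : ay_algebra k := AYAlgebra (cocycle_twist zP).

Lemma twist_inj_linear : linear (fun u : ay_zero M => (0, u) : twist_alg).
Proof. by move=> c u v; apply: injective_projections => /=; rewrite ?scaler0 ?addr0. Qed.

Lemma twist_proj_linear : linear (fun x : twist_alg => x.1).
Proof. by []. Qed.

Definition alg_0 := let P := ay_algebraP A in
  (bilinear_0l (mul_bilinear P), bilinear_0r (mul_bilinear P),
   (trilinear_01 (br_trilinear P), trilinear_02 (br_trilinear P), trilinear_03 (br_trilinear P)),
   (trilinear_01 (dbr_trilinear P), trilinear_02 (dbr_trilinear P), trilinear_03 (dbr_trilinear P))).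

Definition rep_A0 :=
  ((bilinear_0l (mulAM_bilinear V), bilinear_0r (mulMA_bilinear V)),
   (trilinear_01 (brAAM_trilinear V), trilinear_02 (brAAM_trilinear V)),
   (trilinear_01 (brAMA_trilinear V), trilinear_03 (brAMA_trilinear V)),
   (trilinear_02 (brMAA_trilinear V), trilinear_03 (brMAA_trilinear V)),
   (trilinear_01 (dbrAAM_trilinear V), trilinear_02 (dbrAAM_trilinear V)),
   (trilinear_01 (dbrAMA_trilinear V), trilinear_03 (dbrAMA_trilinear V)),
   (trilinear_02 (dbrMAA_trilinear V), trilinear_03 (dbrMAA_trilinear V))).

Definition cocycle_A0 :=
  (bilinear_0l (cocycle_mu zP), bilinear_0r (cocycle_mu zP),
   (trilinear_01 (cocycle_F zP), trilinear_02 (cocycle_F zP), trilinear_03 (cocycle_F zP)),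
   (trilinear_01 (cocycle_G zP), trilinear_02 (cocycle_G zP), trilinear_03 (cocycle_G zP))).

(** Closed by [Defined] so that the carrier, the injection and the projection compute in later
    proofs. *)
Definition twist_ext : ab_extension A M.
Proof.
refine (@AbExtension k A M twist_alg (linear_pack twist_inj_linear)
  (linear_pack twist_proj_linear) _ _ _ _ _ _ _).
- by split=> *; apply: injective_projections;
    rewrite /= ?(alg_0, rep_A0, cocycle_A0, addr0).
- by split.
- by move=> u v [].
- by move=> a; exists (a, 0).
- move=> [a u]; split=> [/= ->|[v [-> _]]] //; by exists u.
(* Every summand uses the [A]-parts of at least two of the three arguments, and here two of these
   parts are 0. *)
- by move=> x u v; split; apply: injective_projections;
    rewrite /= ?(alg_0, rep_A0, rep_0, cocycle_A0, addr0).
- by move=> x u v; split; apply: injective_projections;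
    rewrite /= ?(alg_0, rep_A0, rep_0, cocycle_A0, addr0).
Defined.

(** A section has the form [a |-> (a, g a)]. Any term containing a value of [g] also contains the
    [A]-part of [(0, u)], which is 0, so the choice of section does not matter. *)
Lemma twist_ext_induces : induces V twist_ext.
Proof.
move=> s sP; have s1 a : (s a).1 = a := sP a.
by split=> *; apply: injective_projections;
  rewrite /= ?s1 ?(alg_0, rep_A0, rep_0, cocycle_A0, addr0, add0r).
Qed.

End TwistExtension.
End Twist.

(** * Isomorphisms of extensions, and reduction to twisted ones *)

Section Extensions.
Variables (k : fieldType) (A : ay_algebra k) (M : lmodType k) (V : ay_rep A M).
Implicit Types E : ab_extension A M.

Lemma ext_iso_refl E : ext_iso E E.
Proof. by exists idfun; split=> //; exists id. Qed.

Lemma ext_iso_sym E E' : ext_iso E E' -> ext_iso E' E.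
Proof.
move=> [Phi [[hm hb hd] [Psi PhiK PsiK] Phi_i Phi_p]].
exists (linear_pack (linear_inverse PhiK PsiK)); split=> /=.
- by split=> *; apply: (can_inj PhiK); rewrite ?(hm, hb, hd) /= !PsiK.
- by exists Phi.
- by move=> u; rewrite -Phi_i PhiK.
- by move=> x; rewrite -Phi_p PsiK.
Qed.

Lemma ext_iso_trans E E' E'' : ext_iso E E' -> ext_iso E' E'' -> ext_iso E E''.
Proof.
move=> [f [[fm fb fd] fbij fi fp]] [g [[gm gb gd] gbij gi gp]].
exists (g \o f); split=> /=.
- by split=> *; rewrite /= ?(fm, fb, fd, gm, gb, gd).
- exact: bij_comp.
- by move=> u; rewrite fi gi.
- by move=> x; rewrite gp fp.
Qed.

Lemma ext_iso_eq E E' : ext_iso E E' -> ext_iso E = ext_iso E'.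
Proof.
move=> EE'; apply/funext => F; apply/propext.
by split; apply: ext_iso_trans; [apply: ext_iso_sym|].
Qed.

Lemma twist_ext_isoP z z' (zP : cocycles V z) (z'P : cocycles V z') :
  ext_iso (twist_ext z'P) (twist_ext zP) <->
  exists2 f : A -> M, linear f & z' = z + coboundary_of V f.
Proof.
split=> [[Phi [[hm hb hd] _ Phi_i Phi_p]]|[f lf z'E]].
  (* The shear parameter is the [M]-component of [Phi] on [A * 0]. Compatibility with the
     projections fixes the other component there, and compatibility with the injections fixes [Phi]
     on [0 * M]. *)
  pose f a := (Phi (a, 0)).2.
  have lf : linear f.
    move=> c x y.
    rewrite /f (_ : (c *: x + y, 0) = c *: (x, 0) + (y, 0) :> twist_ext z'P) ?linearP//.
    by apply: injective_projections; rewrite //= scaler0 addr0.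
  have PhiE x : Phi x = shear f x.
    case: x => a u; rewrite /shear /=.
    rewrite (_ : (a, u) = (a, 0) + (0, u) :> twist_ext z'P); last first.
      by apply: injective_projections; rewrite /= ?addr0 ?add0r.
    rewrite linearD (Phi_i u); apply: injective_projections => /=.
      by rewrite addr0; apply: (Phi_p (a, 0)).
    by rewrite addrC.
  exists f => //; apply: injective_projections; first apply: injective_projections.
  - apply/funext => a; apply/funext => b.
    (* Both sides have the same image under the injective shear, by [hm] for [z'] and by [shear_mul]
       for the shifted [z]. *)
    have : twist_mul V z'.1.1 (a, 0) (b, 0) =
        twist_mul V (z + coboundary_of V f).1.1 (a, 0) (b, 0).
      by apply: (@shear_inj _ _ _ f); rewrite shear_mul -!PhiE; apply: hm.
    by move=> /(congr1 snd); rewrite /twist_mul /= !rep_0 !add0r.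
  - apply/funext => a; apply/funext => b; apply/funext => c.
    have : twist_br V z'.1.2 (a, 0) (b, 0) (c, 0) =
        twist_br V (z + coboundary_of V f).1.2 (a, 0) (b, 0) (c, 0).
      by apply: (@shear_inj _ _ _ f); rewrite shear_br -!PhiE; apply: hb.
    by move=> /(congr1 snd); rewrite /twist_br /= !rep_0 !add0r.
  - apply/funext => a; apply/funext => b; apply/funext => c.
    have : twist_dbr V z'.2 (a, 0) (b, 0) (c, 0) =
        twist_dbr V (z + coboundary_of V f).2 (a, 0) (b, 0) (c, 0).
      by apply: (@shear_inj _ _ _ f); rewrite shear_dbr -!PhiE; apply: hd.
    by move=> /(congr1 snd); rewrite /twist_dbr /= !rep_0 !add0r.
subst z'; exists (linear_pack (shear_linear lf)); split.
- split; [exact: shear_mul | exact: shear_br | exact: shear_dbr].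
- exists (shear (fun a => - f a)) => x; apply: injective_projections => //=.
    by rewrite addrK.
  by rewrite subrK.
- move=> u; apply: injective_projections => //=.
  by rewrite (linear_prop0 lf) addr0.
- by [].
Qed.

Lemma ext_proj_inj E u : ext_proj E (ext_inj E u) = 0.
Proof. by apply/ext_exact; exists u. Qed.

Lemma ext_proj_eq E (x y : E) :
  ext_proj E x = ext_proj E y -> exists u, x = y + ext_inj E u.
Proof.
move=> xy; have [u xyu] : exists u, x - y = ext_inj E u.
  by apply/ext_exact; rewrite linearB/= xy subrr.
by exists u; rewrite -xyu addrC subrK.
Qed.

Lemma inj_surj_bijective (T U : Type) (f : T -> U) :
  injective f -> (forall y, exists x, f x = y) -> bijective f.
Proof.
by move=> f_inj /choice[g fgK]; exists g => // x; apply: f_inj; rewrite fgK.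
Qed.

(** A section [s] splits [E] linearly as [A * M] through [psi], and the triple [z] records how far
    [s] is from preserving the three operations. *)
Lemma ext_iso_twist E : induces V E ->
  exists z, exists zP : cocycles V z, ext_iso (twist_ext zP) E.
Proof.
move=> EV; have [s sP] := linear_section (@ext_proj_surjective _ _ _ E).
case: (EV s sP) => iAM iMA iAAM iAMA iMAA jAAM jAMA jMAA.
case: (ext_proj_hom E) => pm pb pd; case: (ext_inj_hom E) => im _ _.
(* The projection is a homomorphism, so each defect lies in its kernel, the image of [M]. Arguments
   are tupled so that [choice] applies once per operation. *)
have /choice[mu muP] (x : A * A) : exists u,
    ay_mul (s x.1) (s x.2) = s (ay_mul x.1 x.2) + ext_inj E u.
  by apply: ext_proj_eq; rewrite pm !sP.
have /choice[F FP] (x : A * A * A) : exists u,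
    ay_br (s x.1.1) (s x.1.2) (s x.2) = s (ay_br x.1.1 x.1.2 x.2) + ext_inj E u.
  by apply: ext_proj_eq; rewrite pb !sP.
have /choice[G GP] (x : A * A * A) : exists u,
    ay_dbr (s x.1.1) (s x.1.2) (s x.2) = s (ay_dbr x.1.1 x.1.2 x.2) + ext_inj E u.
  by apply: ext_proj_eq; rewrite pd !sP.
pose z : cochain A M := (fun a b => mu (a, b), fun a b c => F (a, b, c),
  fun a b c => G (a, b, c)).
pose psi (x : A * M) : E := s x.1 + ext_inj E x.2.
have psi_lin : linear psi.
  by move=> c x y; rewrite /psi !linearP scalerDr addrACA.
have psi_mul x y : psi (twist_mul V z.1.1 x y) = ay_mul (psi x) (psi y).
  case: x y => [a u] [b v]; have P := mul_bilinear (ay_algebraP E).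
  (* Rewriting with [-im] turns the product of two elements of [M] into the image of a product in
     [ay_zero M], which is 0. *)
  rewrite /psi /= !(bilinear_Dl P) !(bilinear_Dr P) (muP (a, b)) -iAM -iMA -im.
  by rewrite !linearD linear0 /=; abelian.
have psi_br x y t : psi (twist_br V z.1.2 x y t) = ay_br (psi x) (psi y) (psi t).
  case: x y t => [a u] [b v] [c w]; have P := br_trilinear (ay_algebraP E).
  rewrite /psi /= !(trilinear_D1 P) !(trilinear_D2 P) !(trilinear_D3 P).
  have vanish := @ext_abelian_br _ _ _ E.
  (* Of the eight terms of the expansion, the four with at least two arguments in [M] vanish. *)
  have [-> _ _] := vanish (s a) v w; have [_ -> _] := vanish (s b) u w.
  have [_ _ ->] := vanish (s c) u v; have [-> _ _] := vanish (ext_inj E u) v w.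
  by rewrite (FP (a, b, c)) -iAAM -iAMA -iMAA !linearD /=; abelian.
have psi_dbr x y t : psi (twist_dbr V z.2 x y t) = ay_dbr (psi x) (psi y) (psi t).
  case: x y t => [a u] [b v] [c w]; have P := dbr_trilinear (ay_algebraP E).
  rewrite /psi /= !(trilinear_D1 P) !(trilinear_D2 P) !(trilinear_D3 P).
  have vanish := @ext_abelian_dbr _ _ _ E.
  have [-> _ _] := vanish (s a) v w; have [_ -> _] := vanish (s b) u w.
  have [_ _ ->] := vanish (s c) u v; have [-> _ _] := vanish (ext_inj E u) v w.
  by rewrite (GP (a, b, c)) -jAAM -jAMA -jMAA !linearD /=; abelian.
have p_psi x : ext_proj E (psi x) = x.1.
  by rewrite /psi linearD /= sP ext_proj_inj addr0.
have psi_inj : injective psi.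
  move=> [a u] [b v] e; have := congr1 (ext_proj E) e; rewrite !p_psi /= => ab.
  by move: e; rewrite ab /psi /= => /addrI/ext_inj_injective->.
have psi_surj x : exists y, psi y = x.
  have [u ->] : exists u, x = s (ext_proj E x) + ext_inj E u.
    by apply: ext_proj_eq; rewrite sP.
  by exists (ext_proj E x, u).
(* The cocycle property comes from transporting the axioms of [E] along the injective map [psi]. *)
exists z; unshelve eexists.
  apply: twist_cocycle.
  exact: (@ay_transport _ _ _ _ _ _ (linear_pack psi_lin)).
exists (linear_pack psi_lin); split.
- by split.
- exact: inj_surj_bijective.
- by move=> u; rewrite /= /psi linear0 add0r.
- exact: p_psi.
Qed.

Lemma is_coset_class (C : H23 V) : exists z, cocycles V z /\ sval C = coset V z.
Proof. by case: C => C /= [z zP ->]; exists z. Qed.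
End Extensions.

Theorem theorem5p3 (k : fieldType) (char_k : [pchar k] =i pred0)
    (A : ay_algebra k) (M : lmodType k) (V : ay_rep A M) :
  exists f : Ext V -> H23 V, bijective f.
Proof.
(* The map is constructed from cosets to classes: [cls] sends a coset to the class of the twist by
   its chosen representative [r C]. The bijection sought is the inverse of [cls]. *)
have /choice[r rP] (C : H23 V) := is_coset_class C.
pose cls (C : H23 V) : Ext V := exist _ (ext_iso (twist_ext (rP C).1))
  (ex_intro2 _ _ _ (@twist_ext_induces _ _ _ _ _ (rP C).1) (erefl _)).
have cls_inj : injective cls.
  move=> C C' /(congr1 sval)/= CC'.
  have : ext_iso (twist_ext (rP C').1) (twist_ext (rP C).1).
    by rewrite -CC'; apply: ext_iso_refl.
  move=> /twist_ext_isoP[f lf rC].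
  case: C C' (rP C) (rP C') rC {CC'} => [C Cc] [C' C'c] /= [_ CE] [_ C'E] rC.
  by apply: eq_exist; rewrite CE C'E rC coset_eq.
(* An extension in the class is isomorphic to a twist by some [z]. The representative chosen in the
   coset of [z] may differ from [z], but only by a coboundary, so the two twists are isomorphic. *)
have /choice[inv invP] (X : Ext V) : exists C, cls C = X.
  case: X => S SE; have [E EV SE'] := SE.
  have [z [zP zE]] := ext_iso_twist EV.
  pose C : H23 V := exist _ (coset V z) (ex_intro2 _ _ z zP (erefl _)).
  exists C; apply: eq_exist; rewrite SE'; apply: ext_iso_eq; apply: ext_iso_trans zE.
  have [b [_ [f lf <-]] bE] : coset V (r C) z.
    by rewrite -(rP C).2; apply: coset_refl.
  by apply: ext_iso_sym; apply/twist_ext_isoP; exists f.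
exists inv; exists cls => // C; exact/cls_inj/invP.
Qed.
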